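(* Let $F':\mathbb{C}^{10}\cong\mathbb{R}^{20}\to\mathbb{R}$ be defined, for $z=(z_1,\dots,z_{10})$ with $z_j=x_j+\sqrt{-1}\,y_j$, by $$\begin{aligned}F'(z)=\Big(\sum_{i=1}^{10}|z_i|^2\Big)^2-8\Big\{&|z_5z_{10}-z_6z_9+z_7z_8|^2+|-z_2z_{10}+z_3z_9-z_4z_8|^2\\&+|z_1z_{10}-z_3z_7+z_4z_6|^2+|-z_1z_9+z_2z_7-z_4z_5|^2+|z_1z_8-z_2z_6+z_3z_5|^2\Big\}.\end{aligned}$$ Then the positive semidefinite form $G_{F'}^+(z)=|z|^4+F'(z)$ on $\mathbb{R}^{20}$ is not a sum of squares of real polynomials (in the 20 real variables $x_j,y_j$).
   Context: $F'$ is the isoparametric polynomial with $g=4$ and $(m_+,m_-)=(5,4)$; $|z|^2=\sum_{i}|z_i|^2$. A real polynomial is a sum of squares if it equals $\sum_j h_j^2$ for finitely many real polynomials $h_j$. *)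

(* Defs.v *)
From mathcomp Require Import all_boot all_order all_algebra.
From mathcomp Require Import reals.
From mathcomp Require Import complex mpoly.

Set Implicit Arguments.
Unset Strict Implicit.
Unset Printing Implicit Defensive.

Import Order.TTheory GRing.Theory Num.Theory.

Local Open Scope ring_scope.

Section Definitions.
Variable R : realType.

(* The identification C^10 = R^20; the real coordinates are ordered as
   (x_1, ..., x_10, y_1, ..., y_10). *)
Definition realify (z : 'rV[R[i]]_10) : 'rV[R]_20 :=
  row_mx (map_mx (@complex.Re R) z) (map_mx (@complex.Im R) z).

(* [normc] is the R-valued modulus; the norm `|w| of R[i] is R[i]-valued. *)
Definition abs2 (w : R[i]) : R := Normc.normc w ^+ 2.

Definition norm2 (z : 'rV[R[i]]_10) : R := \sum_(i < 10) abs2 (z 0 i).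

(* The coordinate v_k, with k numbered from 1 to 10. *)
Definition coord (v : 'rV[R[i]]_10) (k : nat) : R[i] := v 0 (inord k.-1).

Definition F' (v : 'rV[R[i]]_10) : R :=
  let z := coord v in
  norm2 v ^+ 2
  - 8 * (abs2 (z 5%N * z 10%N - z 6%N * z 9%N + z 7%N * z 8%N)
         + abs2 (- (z 2%N * z 10%N) + z 3%N * z 9%N - z 4%N * z 8%N)
         + abs2 (z 1%N * z 10%N - z 3%N * z 7%N + z 4%N * z 6%N)
         + abs2 (- (z 1%N * z 9%N) + z 2%N * z 7%N - z 4%N * z 5%N)
         + abs2 (z 1%N * z 8%N - z 2%N * z 6%N + z 3%N * z 5%N)).

Definition GF'_plus (z : 'rV[R[i]]_10) : R := norm2 z ^+ 2 + F' z.

Definition is_sos (n : nat) (p : {mpoly R[n]}) : Prop :=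
  exists s : seq {mpoly R[n]}, p = \sum_(h <- s) h ^+ 2.

(* [p] is the polynomial expression, in the variables x_j, y_j, of the
   function [f]; since R is infinite, there is at most one such [p]. *)
Definition represents (p : {mpoly R[20]}) (f : 'rV[R[i]]_10 -> R) : Prop :=
  forall z : 'rV[R[i]]_10, p.@[fun k => realify z 0 k] = f z.

End Definitions.

(* Main.v *)
(* Read z as a 2-form w on C^5, with coordinates z_1, ..., z_10 on e_12, e_13,
   e_14, e_15, e_23, e_24, e_25, e_34, e_35, e_45. The five quadrics are, up to
   sign, the Pfaffians P_i of w, so G / 2 = |w|^4 - 4 |P|^2.
   Nonnegativity: for u in C^5 one has u /\ w /\ w = 2 sum_i u_i P_i and
   |u /\ w|^2 + |i_u w|^2 = |u|^2 |w|^2; apply Cauchy-Schwarz with u the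
   conjugate of P.
   Not a sum of squares: if G = sum_j h_j^2, then also G = sum_j q_j^2 with q_j
   the quadratic part of h_j, and each q_j vanishes on the zeros of G. For
   disjoint pairs, e_ij + e_kl and e_ij - e_kl are zeros of G, whence
   q_j(e_ij) = - q_j(e_kl). The disjointness graph of the pairs (the Petersen
   graph) has the 5-cycle 12, 34, 15, 23, 45, so q_j(e_12) = 0 for all j,
   whereas G(e_12) = 2. *)
Require Import Defs.
From mathcomp Require Import all_boot all_order all_algebra.
From mathcomp Require Import reals.
From mathcomp Require Import complex mpoly.
From mathcomp Require Import ring lra.

Set Implicit Arguments.
Unset Strict Implicit.
Unset Printing Implicit Defensive.

Import Order.TTheory GRing.Theory Num.Theory.

Local Open Scope ring_scope.

(** * Pfaffians, wedge and contraction of 2-forms on a 5-dimensional space *)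

Section Forms.
Variable T : comPzRingType.
Implicit Types (x y z u : nat -> T).

Definition pf z (i : nat) : T :=
  match i with
  | 0%N => z 4%N * z 9%N - z 5%N * z 8%N + z 6%N * z 7%N
  | 1%N => - (z 1%N * z 9%N) + z 2%N * z 8%N - z 3%N * z 7%N
  | 2%N => z 0%N * z 9%N - z 2%N * z 6%N + z 3%N * z 5%N
  | 3%N => - (z 0%N * z 8%N) + z 1%N * z 6%N - z 3%N * z 4%N
  | _ => z 0%N * z 7%N - z 1%N * z 5%N + z 2%N * z 4%N
  end.

Lemma eq_pf x z i : (forall k, (k < 10)%N -> x k = z k) -> pf x i = pf z i.
Proof. by move=> xz; case: i => [|[|[|[|i]]]] /=; rewrite !xz. Qed.

(* The Hodge dual of u /\ z, namely the k-th partial derivative of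
   sum_i u_i pf z i. *)
Definition wedge u z (k : nat) : T :=
  match k with
  | 0%N => u 2%N * z 9%N - u 3%N * z 8%N + u 4%N * z 7%N
  | 1%N => - (u 1%N * z 9%N) + u 3%N * z 6%N - u 4%N * z 5%N
  | 2%N => u 1%N * z 8%N - u 2%N * z 6%N + u 4%N * z 4%N
  | 3%N => - (u 1%N * z 7%N) + u 2%N * z 5%N - u 3%N * z 4%N
  | 4%N => u 0%N * z 9%N - u 3%N * z 3%N + u 4%N * z 2%N
  | 5%N => - (u 0%N * z 8%N) + u 2%N * z 3%N - u 4%N * z 1%N
  | 6%N => u 0%N * z 7%N - u 2%N * z 2%N + u 3%N * z 1%N
  | 7%N => u 0%N * z 6%N - u 1%N * z 3%N + u 4%N * z 0%N
  | 8%N => - (u 0%N * z 5%N) + u 1%N * z 2%N - u 3%N * z 0%N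
  | _ => u 0%N * z 4%N - u 1%N * z 1%N + u 2%N * z 0%N
  end.

(** The skew matrix of [z] applied to [u], that is, minus the interior product of [z] by [u]. *)
Definition contract u z (j : nat) : T :=
  match j with
  | 0%N => u 1%N * z 0%N + u 2%N * z 1%N + u 3%N * z 2%N + u 4%N * z 3%N
  | 1%N => - (u 0%N * z 0%N) + u 2%N * z 4%N + u 3%N * z 5%N + u 4%N * z 6%N
  | 2%N => - (u 0%N * z 1%N) - u 1%N * z 4%N + u 3%N * z 7%N + u 4%N * z 8%N
  | 3%N => - (u 0%N * z 2%N) - u 1%N * z 5%N - u 2%N * z 7%N + u 4%N * z 9%N
  | _ => - (u 0%N * z 3%N) - u 1%N * z 6%N - u 2%N * z 8%N - u 3%N * z 9%N
  end.

(* With z', u' conjugate to z, u, this expands |*(u /\ z) - c z'|^2. *)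
Lemma wedge_contract_identity (z z' u u' : nat -> T) (c : T) :
  \sum_(k < 10) (wedge u z k - c * z' k) * (wedge u' z' k - c * z k)
  + \sum_(j < 5) contract u' z j * contract u z' j
  = (\sum_(i < 5) u i * u' i) * (\sum_(k < 10) z k * z' k)
    - 2 * c * (\sum_(i < 5) u i * pf z i + \sum_(i < 5) u' i * pf z' i)
    + c ^+ 2 * (\sum_(k < 10) z k * z' k).
Proof. rewrite !big_ord_recr !big_ord0 /=; ring. Qed.

(* Polarization: the imaginary part of pf (x + i y) is
   pf (x + y) - pf x - pf y. *)
Definition gform x y : T :=
  2 * (\sum_(k < 10) (x k ^+ 2 + y k ^+ 2)) ^+ 2
  - 8 * \sum_(i < 5) ((pf x i - pf y i) ^+ 2
                      + (pf (x \+ y) i - pf x i - pf y i) ^+ 2).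

End Forms.

(** * Compatibility with ring morphisms, for use with conjugation and evaluation *)

Section Morphisms.
Variables (S T : comPzRingType) (f : {rmorphism S -> T}).

Lemma rmorph_pf z i : f (pf z i) = pf (f \o z) i.
Proof.
by case: i => [|[|[|[|i]]]] /=; rewrite !(rmorphD, rmorphN, rmorphM).
Qed.

Lemma rmorph_wedge u z k : f (wedge u z k) = wedge (f \o u) (f \o z) k.
Proof.
by case: k => [|[|[|[|[|[|[|[|[|k]]]]]]]]] /=;
  rewrite !(rmorphD, rmorphN, rmorphM).
Qed.

Lemma rmorph_contract u z j : f (contract u z j) = contract (f \o u) (f \o z) j.
Proof.
by case: j => [|[|[|[|j]]]] /=; rewrite !(rmorphD, rmorphN, rmorphM).
Qed.

Lemma rmorph_gform x y : f (gform x y) = gform (f \o x) (f \o y).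
Proof.
rewrite /gform rmorphB rmorphM rmorphXn (rmorphM f 8) !rmorph_nat !rmorph_sum.
congr (_ * _ ^+ 2 - _ * _); apply: eq_bigr => i _; rewrite rmorphD !rmorphXn //.
rewrite !rmorphB !rmorph_pf; congr (_ + (_ - _ - _) ^+ 2).
by case: i => -[|[|[|[|i]]]] ? /=; rewrite !rmorphD.
Qed.

End Morphisms.

Lemma pf_sum_le (C : numClosedFieldType) (z : nat -> C) :
  4 * \sum_(i < 5) `|pf z i| ^+ 2 <= (\sum_(k < 10) `|z k| ^+ 2) ^+ 2.
Proof.
set N := \sum_(i < 5) _; set W := \sum_(k < 10) _.
pose z' k := (z k)^*%R; pose u i := (pf z i)^*%R.
have N_ge0 : 0 <= N by apply: sumr_ge0 => i _; apply: exprn_ge0.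
have W_ge0 : 0 <= W by apply: sumr_ge0 => i _; apply: exprn_ge0.
(* For real [c] the left side of [wedge_contract_identity] is a sum of squared moduli, because [u]
   is the conjugate of [pf z]. *)
have main c : c^*%R = c -> 0 <= N * W - 4 * c * N + c ^+ 2 * W.
  move=> cc.
  have := wedge_contract_identity z z' u (pf z) c.
  have -> : \sum_(k < 10) z k * z' k = W.
    by apply: eq_bigr => k _; rewrite normCK.
  have -> : \sum_(i < 5) u i * pf z i = N.
    by apply: eq_bigr => i _; rewrite normCK mulrC.
  have -> : \sum_(i < 5) pf z i * pf z' i = N.
    apply: eq_bigr => i _; rewrite normCK.
    by rewrite [in RHS](rmorph_pf Num.conj).
  have -> : N * W - 4 * c * N + c ^+ 2 * W
          = N * W - 2 * c * (N + N) + c ^+ 2 * W by ring.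
  move=> <-; apply: addr_ge0; apply: sumr_ge0 => k _.
    suff -> : wedge (pf z) z' k - c * z k = (wedge u z k - c * z' k)^*%R.
      by rewrite -normCK exprn_ge0.
    rewrite rmorphB rmorphM /= cc /z' conjCK (rmorph_wedge Num.conj).
    congr (_ - _).
    by case: k => -[|[|[|[|[|[|[|[|[|k]]]]]]]]] ? /=; rewrite /u !conjCK.
  suff -> : contract u z' k = (contract (pf z) z k)^*%R.
    by rewrite -normCK exprn_ge0.
  by rewrite (rmorph_contract Num.conj).
have [W0|W_neq0] := eqVneq W 0.
  have := main 1 (rmorph1 _); rewrite W0 !mulr0 add0r addr0 mulr1 oppr_ge0.
  by rewrite expr0n.
have W_gt0 : 0 < W by rewrite lt_def W_neq0.
(* The minimum over [c] is at [2 * N / W], which is [W / 2] in the equality case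
   [4 * N = W ^+ 2]. *)
have Wr : (W / 2)^*%R = W / 2 by rewrite geC0_conj // divr_ge0.
have := main _ Wr.
have -> : N * W - 4 * (W / 2) * N + (W / 2) ^+ 2 * W
        = W / 4 * (W ^+ 2 - 4 * N) by field.
by rewrite pmulr_rge0 ?divr_gt0 // subr_ge0.
Qed.

(** * Restriction of polynomials to lines through the origin *)

Section Lines.
Variables (n : nat) (R : comNzRingType).
Implicit Types (p q : {mpoly R[n]}) (u v : 'I_n -> R).

(** Its coefficient of degree d is the value at [v] of the degree d part of [p], so homogeneous
    parts need not be constructed. *)
Definition line v p : {poly R} := mmap (@polyC R) (fun i => v i *: 'X) p.

Lemma line_homog d p v : p \is d.-homog -> line v p = p.@[v] *: 'X^d.
Proof.
move=> /dhomogP hp; rewrite /line /meval /mmap scaler_suml.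
rewrite big_seq [RHS]big_seq; apply: eq_bigr => m mp.
rewrite mul_polyC -scalerA; congr (_ *: _).
have := hp _ mp; rewrite /= mdegE => <-.
rewrite /mmap1 -prodrXr -scaler_prod.
by apply: eq_bigr => i _; rewrite exprZn.
Qed.

(* Degree at most 2 in the direction [v]: the degree 0, 1, 2 parts of [p] are
   a constant, a linear form and a quadratic form with polar value [b]. *)
Let taylor2 u v p := exists b, forall a,
  let w i := u i + a * v i in
  [/\ (line w p)`_0 = (line u p)`_0, (line v p)`_0 = (line u p)`_0,
      (line w p)`_1 = (line u p)`_1 + a * (line v p)`_1 &
      (line w p)`_2 = (line u p)`_2 + a * b + a ^+ 2 * (line v p)`_2].

Let lineD w p q : line w (p + q) = line w p + line w q.
Proof. exact: mmapD. Qed.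

Let lineM w p q : line w (p * q) = line w p * line w q.
Proof. by rewrite /line rmorphM. Qed.

Let taylor2D u v p q :
  taylor2 u v p -> taylor2 u v q -> taylor2 u v (p + q).
Proof.
move=> [b hb] [b' hb']; exists (b + b') => a /=.
have [p0 p0' p1 p2] := hb a; have [q0 q0' q1 q2] := hb' a.
rewrite !lineD !coefD p0 p0' p1 p2 q0 q0' q1 q2; split=> //; ring.
Qed.

Let taylor2M u v p q :
  taylor2 u v p -> taylor2 u v q -> taylor2 u v (p * q).
Proof.
move=> [b hb] [b' hb'].
(* This is the coefficient of [a] in p_0 q_2 + p_1 q_1 + p_2 q_0, taken along [u + a v]. *)
exists ((line u p)`_0 * b' + (line u p)`_1 * (line v q)`_1
        + (line v p)`_1 * (line u q)`_1 + b * (line u q)`_0) => a /=.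
have [p0 p0' p1 p2] := hb a; have [q0 q0' q1 q2] := hb' a.
rewrite !lineM !coefM !big_ord_recr !big_ord0 /= !subn0 !subSS !subn0.
rewrite p0 p0' p1 p2 q0 q0' q1 q2; split=> //; ring.
Qed.

Let taylor2C u v c : taylor2 u v c%:MP.
Proof.
exists 0 => a; rewrite /line !mmapC !coefC /=; split=> //; ring.
Qed.

Let taylor2X u v i : taylor2 u v 'X_i.
Proof.
exists 0 => a; rewrite /line !mmapX !mmap1U !coefZ !coefX /=; split; ring.
Qed.

(** The degree 2 coefficient of a product involves those of degree 0 and 1, so the induction is run
    on [taylor2], which is stable under sums and products. *)
Lemma line_coef2 p u v : exists b, forall a,
  (line (fun i => u i + a * v i) p)`_2
  = (line u p)`_2 + a * b + a ^+ 2 * (line v p)`_2.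
Proof.
suff [b hb] : taylor2 u v p by exists b => a; have [] := hb a.
elim/mpolyind: p => [|c m p _ _ IH]; first exact: (taylor2C u v 0).
apply: taylor2D IH; rewrite -mul_mpolyC; apply: taylor2M; first exact: taylor2C.
rewrite mpolyXE_id; elim/big_ind: _ => [||i _]; first exact: (taylor2C u v 1).
  exact: taylor2M.
elim: (m i) => [|k IHk]; first exact: (taylor2C u v 1).
by rewrite exprS; apply: taylor2M.
Qed.

End Lines.

(** * Sums of squares that are quartic forms *)

Lemma sum_sqr_eq0 (I : eqType) (R : realDomainType) (s : seq I) (F : I -> R) :
  \sum_(i <- s) F i ^+ 2 = 0 -> forall i, i \in s -> F i = 0.
Proof.
move=> /eqP; rewrite psumr_eq0 => [/allP s0 i /s0|? _]; last exact: sqr_ge0.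
by rewrite /= sqrf_eq0 => /eqP.
Qed.

(** Along a line the sum is a multiple of ['X^4]. Its coefficients of degree 0 and 2 force the
    constant, then the linear terms to vanish. In degree 4 this also removes the products with terms
    of degree 3 and 4. *)
Lemma sos_homog4 (n : nat) (R : realDomainType) (s : seq {mpoly R[n]}) v :
  (\sum_(h <- s) h ^+ 2 : {mpoly R[n]}) \is 4.-homog ->
  (\sum_(h <- s) h ^+ 2).@[v] = \sum_(h <- s) (line v h)`_2 ^+ 2.
Proof.
move=> /line_homog -/(_ v); rewrite {1}/line rmorph_sum /=.
under eq_bigr do rewrite rmorphXn /= -/(line v _) expr2.
set e := _.@[v] => E.
have coefE k : \sum_(h <- s) (line v h * line v h)`_k = e * (k == 4%N)%:R.
  by rewrite -coef_sum E coefZ coefXn.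
have h0 : forall h, h \in s -> (line v h)`_0 = 0.
  apply: (sum_sqr_eq0 (F := fun h => (line v h)`_0)).
  apply: etrans (etrans (coefE 0%N) (mulr0 e)).
  by apply: eq_bigr => h' _; rewrite coefM big_ord_recr big_ord0 /= add0r.
have h1 : forall h, h \in s -> (line v h)`_1 = 0.
  apply: (sum_sqr_eq0 (F := fun h => (line v h)`_1)).
  apply: etrans (etrans (coefE 2%N) (mulr0 e)).
  rewrite big_seq [RHS]big_seq; apply: eq_bigr => h' hs.
  rewrite coefM !big_ord_recr big_ord0 /= (h0 _ hs).
  by rewrite mul0r mulr0 !add0r addr0.
have := coefE 4%N; rewrite mulr1 => <-.
rewrite big_seq [RHS]big_seq; apply: eq_bigr => h hs.
rewrite coefM !big_ord_recr big_ord0 /= (h0 h hs) (h1 h hs).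
by rewrite !(mul0r, mulr0, add0r, addr0) expr2.
Qed.

(** * The quartic form on R^20, its sign and its zeros *)

Section Main.
Variable R : realType.

Definition Gpoly : {mpoly R[20]} :=
  gform (fun k => 'X_(inord k)) (fun k => 'X_(inord (10 + k))).

Lemma Gpoly_eval v :
  Gpoly.@[v] = gform (fun k => v (inord k)) (fun k => v (inord (10 + k))).
Proof.
rewrite /Gpoly (rmorph_gform (meval v)) /gform.
congr (_ * _ ^+ 2 - _ * _); apply: eq_bigr => i _; rewrite /= ?mevalXU //.
by case: i => -[|[|[|[|i]]]] ? /=; rewrite !mevalXU.
Qed.

Lemma Gpoly_homog : Gpoly \is 4.-homog.
Proof.
have X1 i : ('X_i : {mpoly R[20]}) \is 1.-homog by rewrite dhomogX /= mdeg1.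
have pf2 (x : nat -> {mpoly R[20]}) i :
    (forall k, x k \is 1.-homog) -> pf x i \is 2.-homog.
  move=> x1; case: i => [|[|[|[|i]]]] /=;
    by rewrite ?(rpredD, rpredN) ?(dhomogM (d := 1) (e := 1)).
rewrite /Gpoly /gform !mulr_natl rpredB // rpredMn //.
  apply: (@dhomogMn _ _ _ 2 _ 2); apply: rpred_sum => k _.
  by rewrite rpredD // (@dhomogMn _ _ _ 1 _ 2).
apply: rpred_sum => i _; rewrite rpredD // (@dhomogMn _ _ _ 2 _ 2) //.
  by rewrite rpredB // pf2.
by rewrite !rpredB // pf2 // => k; rewrite rpredD.
Qed.

Lemma abs2E (w : R[i]) : abs2 w = complex.Re w ^+ 2 + complex.Im w ^+ 2.
Proof. by case: w => a b; rewrite /abs2 /= sqr_sqrtr // addr_ge0 ?sqr_ge0. Qed.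

Lemma GF'_plusE (z : 'rV[R[i]]_10) :
  GF'_plus z = 2 * norm2 z ^+ 2
    - 8 * \sum_(i < 5) abs2 (pf (fun k => z 0 (inord k)) i).
Proof.
rewrite /GF'_plus /F' !big_ord_recr big_ord0 /= /coord /=; ring.
Qed.

Lemma abs2_pf (z : nat -> R[i]) i :
  let x k := complex.Re (z k) in let y k := complex.Im (z k) in
  abs2 (pf z i)
  = (pf x i - pf y i) ^+ 2 + (pf (x \+ y) i - pf x i - pf y i) ^+ 2.
Proof.
move=> x y; rewrite abs2E; congr (_ ^+ 2 + _ ^+ 2).
  case: i => [|[|[|[|i]]]]; rewrite /= /x /y;
  do ![case: (z _) => ? ?]; rewrite /=; ring.
case: i => [|[|[|[|i]]]]; rewrite /= /x /y;
do ![case: (z _) => ? ?]; rewrite /=; ring.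
Qed.

Lemma Gpoly_represents : represents Gpoly (@GF'_plus R).
Proof.
move=> z; rewrite Gpoly_eval GF'_plusE.
have reE (k : 'I_10) : realify z 0 (inord k) = complex.Re (z 0 k).
  have -> : inord k = lshift 10 k :> 'I_20.
    by apply: val_inj; rewrite /= inordK // (ltn_trans (ltn_ord k)).
  by rewrite [LHS](row_mxEl _ _ 0 k) mxE.
have imE (k : 'I_10) : realify z 0 (inord (10 + k)) = complex.Im (z 0 k).
  have -> : inord (10 + k) = rshift 10 k :> 'I_20.
    by apply: val_inj; rewrite /= inordK // (ltn_add2l 10 k 10).
  by rewrite [LHS](row_mxEr _ _ 0 k) mxE.
rewrite /gform /norm2; congr (_ * _ ^+ 2 - _ * _); apply: eq_bigr => i _.
  by rewrite reE imE abs2E.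
rewrite abs2_pf.
have reE' k : (k < 10)%N ->
    realify z 0 (inord k) = complex.Re (z 0 (inord k)).
  by move=> k10; rewrite -reE inordK.
have imE' k : (k < 10)%N ->
    realify z 0 (inord (10 + k)) = complex.Im (z 0 (inord k)).
  by move=> k10; rewrite -imE inordK.
by congr ((_ - _) ^+ 2 + (_ - _ - _) ^+ 2); apply: eq_pf => k k10 /=;
  rewrite ?(reE' _ k10) ?(imE' _ k10).
Qed.

Lemma GF'_plus_ge0 (z : 'rV[R[i]]_10) : 0 <= GF'_plus z.
Proof.
rewrite GF'_plusE subr_ge0.
suff : 4 * \sum_(i < 5) abs2 (pf (fun k => z 0 (inord k)) i) <= norm2 z ^+ 2.
  lra.
(* The inequality is moved into [R[i]], where [pf_sum_le] applies. *)
have abs2C (w : R[i]) : (abs2 w)%:C%C = `|w| ^+ 2.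
  by rewrite abs2E add_Re2_Im2.
have norm2C : (norm2 z)%:C%C = \sum_(k < 10) `|z 0 (inord k)| ^+ 2.
  by rewrite rmorph_sum; apply: eq_bigr => k _; rewrite /= abs2C inord_val.
rewrite -lecR rmorphM rmorphXn /= norm2C rmorph_sum rmorph_nat /=.
under eq_bigr do rewrite abs2C.
exact: pf_sum_le (fun k => z 0 (inord k)).
Qed.

Lemma Gpoly_ge0 (v : 'I_20 -> R) : 0 <= Gpoly.@[v].
Proof.
pose z : 'rV[R[i]]_10 := \row_(j < 10) (v (lshift 10 j) +i* v (rshift 10 j))%C.
suff <- : Gpoly.@[fun k => realify z 0 k] = Gpoly.@[v].
  by rewrite Gpoly_represents GF'_plus_ge0.
apply: meval_eq => k.
by have [j ->|j ->] := @split_ordP 10 10 k;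
  rewrite [LHS](row_mxEl, row_mxEr) !mxE.
Qed.

Definition delta (a : nat) (i : 'I_20) : R := (i == a :> nat)%:R.

Lemma Gpoly_delta_neq0 : Gpoly.@[delta 0] != 0.
Proof.
rewrite Gpoly_eval /gform !big_ord_recr !big_ord0 /= /delta !inordK //=.
set e := (X in X != 0); have -> : e = 2 by rewrite /e; ring.
by rewrite pnatr_eq0.
Qed.

(* The edges of the 5-cycle 12, 34, 15, 23, 45, in coordinates numbered from 0. *)
Lemma Gpoly_zero a b c :
  (a, b) \in [:: (0, 7); (3, 7); (3, 4); (9, 4); (0, 9)]%N -> c ^+ 2 = 1 ->
  Gpoly.@[fun i => delta a i + c * delta b i] = 0.
Proof.
move=> ab c1.
rewrite Gpoly_eval /gform !big_ord_recr !big_ord0 /= /delta !inordK //=.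
(* Exactly one Pfaffian survives, with value [c] up to sign, and
   [2 * (1 + c ^+ 2) ^+ 2 - 8 * c ^+ 2] is this square. *)
transitivity (2 * (c ^+ 2 - 1) ^+ 2); last by rewrite c1 subrr expr0n mulr0.
move: ab; rewrite !inE => /or4P[||| /orP[]] /eqP[-> ->] /=; ring.
Qed.

Lemma Gpoly_not_sos : ~ is_sos Gpoly.
Proof.
move=> [s Gs].
have GE v : Gpoly.@[v] = \sum_(h <- s) (line v h)`_2 ^+ 2.
  by rewrite Gs sos_homog4 // -Gs Gpoly_homog.
have zero v h : Gpoly.@[v] = 0 -> h \in s -> (line v h)`_2 = 0.
  by rewrite GE => /sum_sqr_eq0; apply.
have opp a b h : (a, b) \in [:: (0, 7); (3, 7); (3, 4); (9, 4); (0, 9)]%N ->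
    h \in s -> (line (delta a) h)`_2 = - (line (delta b) h)`_2.
  move=> ab hs; have [q hq] := line_coef2 h (delta a) (delta b).
  have N1 : (-1) ^+ 2 = 1 :> R by rewrite sqrrN expr1n.
  (* Adding the equations for the signs 1 and -1 cancels the polar term [q]. *)
  have := zero _ _ (Gpoly_zero ab (expr1n _ 2)) hs.
  have := zero _ _ (Gpoly_zero ab N1) hs.
  rewrite !hq; lra.
have := Gpoly_delta_neq0; rewrite GE big_seq big1 ?eqxx // => h hs.
(* Five sign changes around the odd cycle equate the value at [delta 0] with its opposite. *)
have h1 := opp 0%N 7%N h isT hs; have h2 := opp 3%N 7%N h isT hs.
have h3 := opp 3%N 4%N h isT hs; have h4 := opp 9%N 4%N h isT hs.
have h5 := opp 0%N 9%N h isT hs.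
have -> : (line (delta 0) h)`_2 = 0 by lra.
by rewrite expr0n.
Qed.

End Main.

Theorem corollary3p4 (R : realType) :
  exists G : {mpoly R[20]},
    [/\ represents G (@GF'_plus R),
        G \is 4.-homog,
        forall v : 'I_20 -> R, 0 <= G.@[v]
      & ~ is_sos G].
Proof.
exists (Gpoly R); split.
- exact: Gpoly_represents.
- exact: Gpoly_homog.
- exact: Gpoly_ge0.
- exact: Gpoly_not_sos.
Qed.
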